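(* Let $n$ be a positive integer and let $r_1,\ldots,r_n$ be positive real numbers. Then the following statements are equivalent: (1) Every homothetic packing of $n$ squares with radii $r_1,\ldots,r_n$ has at most $2n-2$ contacts. (2) The only function $\sigma:[n]\to\{-1,0,1\}$ that takes the value $0$ at least $4$ times and satisfies $\sum_{i=1}^n \sigma_i r_i = 0$ is the zero function.
   Context: Let $S=\{(x,y): -1\le x,y\le 1\}\subset\mathbb{R}^2$ and $[n]=\{1,\ldots,n\}$. A homothetic copy of $S$ is a set $rS+p=\{rx+p: x\in S\}$ with $r>0$, $p\in\mathbb{R}^2$. A homothetic packing of $n$ squares is a set $P=\{S_1,\ldots,S_n\}$ of homothetic copies $S_i=r_iS+p_i$ of $S$ such that for distinct $i,j$ the interiors of $S_i$ and $S_j$ are disjoint; $r_1,\ldots,r_n$ are its radii and $p_1,\ldots,p_n$ its centres. A contact of $P$ is an unordered pair $\{i,j\}$ of distinct indices with $S_i\cap S_j\neq\emptyset$; the number of contacts is the number of such pairs. *)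

(* Defs.v *)
From mathcomp Require Import all_boot all_order all_algebra.
From mathcomp Require Import boolp Rstruct.
From Stdlib Require Rdefinitions.
Notation R := Rdefinitions.R.
Set Implicit Arguments. Unset Strict Implicit. Unset Printing Implicit Defensive.
Import Order.TTheory GRing.Theory Num.Theory.
Local Open Scope ring_scope.

Definition point := (R * R)%type.

(* The homothetic copy r S + p of S = [-1,1]^2 (a closed axis-parallel square). *)
Definition hsquare (r : R) (p : point) : point -> Prop :=
  fun q => `|q.1 - p.1| <= r /\ `|q.2 - p.2| <= r.

Definition hsquare_int (r : R) (p : point) : point -> Prop :=
  fun q => `|q.1 - p.1| < r /\ `|q.2 - p.2| < r.

Definition is_packing (n : nat) (r : 'I_n -> R) (p : 'I_n -> point) : Prop :=
  forall i j : 'I_n, i != j ->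
    forall q : point, ~ (hsquare_int (r i) (p i) q /\ hsquare_int (r j) (p j) q).

Definition contacts (n : nat) (r : 'I_n -> R) (p : 'I_n -> point) : nat :=
  #|[set ij : 'I_n * 'I_n | (ij.1 < ij.2)%N &&
      `[< exists q : point, hsquare (r ij.1) (p ij.1) q /\ hsquare (r ij.2) (p ij.2) q >] ]|.

(* Main.v *)
(* Label every contact as horizontal or vertical, a corner contact of positive slope being
   horizontal and one of negative slope vertical, and orient it to the right, resp. upwards.
   Going around a cycle of horizontal contacts the x-coordinates give a relation
   [sum_i sigma_i r_i = 0], where [sigma_i = 0] exactly when [i] is off the cycle or is a turning
   point of it.  The corner convention forbids cycles in which every vertex turns, so by (2) there
   are at most three zeros; the number of turning points being even and positive, there are two,
   [A] (leftmost) and [B] (rightmost), and at most one square [D] is off the cycle.  In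
   particular either contact graph becomes a forest once two vertices are deleted.  If some cycle
   is horizontal, then [A] and [B] have horizontal degree 2 on the cycle and no vertical
   neighbour there, and deleting them (together with a discussion of the neighbours of [D])
   gives at most [2n-2] contacts; if there is no cycle at all, both graphs have at most [n-1] edges.

   Conversely, from a nonzero [sigma] with four zeros one stacks the squares in two columns along
   a vertical line, always on the lower column, which creates two contacts for each new square,
   and one more for the second square placed when the columns have equal heights.  Starting with
   two zeros, then balancing the squares with [sigma = 1] against those with [sigma = -1], then
   two zeros again, equal heights occur twice, which gives [2n-1] contacts. *)
Require Import Defs.
From mathcomp Require Import all_boot all_order all_algebra.
From mathcomp Require Import boolp Rstruct.
From mathcomp Require Import zify ring lra.
From Stdlib Require Rdefinitions.
Set Implicit Arguments.
Unset Strict Implicit.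
Unset Printing Implicit Defensive.
Import Order.TTheory GRing.Theory Num.Theory.
Local Open Scope ring_scope.

(** * Oriented finite graphs: cycles and forests *)

Definition sym_rel (I : finType) (e : rel I) : rel I := fun i j => e i j || e j i.
Arguments sym_rel I e i j /.

Lemma sym_relC (I : finType) (e : rel I) i j : sym_rel e i j = sym_rel e j i.
Proof. by rewrite /= orbC. Qed.

Definition degree_in (I : finType) (e : rel I) (S : {set I}) (v : I) : nat :=
  #|[set w in S | sym_rel e v w]|.

Definition arcs_in (I : finType) (e : rel I) (S : {set I}) : nat :=
  #|[set p : I * I | [&& p.1 \in S, p.2 \in S & e p.1 p.2]]|.

Lemma card_gt1_other (I : finType) (A : {set I}) (x : I) :
  (1 < #|A|)%N -> exists2 y, y \in A & y != x.
Proof.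
move=> /card_gt1P [a [b [aA bA ab]]].
have [ax|ax] := eqVneq a x; last by exists a.
by exists b => //; rewrite -ax eq_sym.
Qed.

(* The first vertex of a longest simple path has a second neighbour, which must lie on the path. *)
Lemma cycle_of_degree_gt1 (I : finType) (e : rel I) (S : {set I}) :
  irreflexive e -> S != set0 ->
  (forall v, v \in S -> (1 < degree_in e S v)%N) ->
  exists c, [/\ ucycle (sym_rel e) c, (2 < size c)%N & {subset c <= S}].
Proof.
move=> irr /set0Pn [x0 x0S] deg.
pose good k := [exists t : k.-tuple I,
  [&& all (mem S) t, uniq t & sorted (sym_rel e) t]].
have ex0 : exists k, good k.
  by exists 1%N; apply/existsP; exists [tuple x0]; rewrite /= x0S.
have bnd k : good k -> (k <= #|I|)%N.
  case/existsP=> t /and3P [_ ut _].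
  by rewrite -(size_tuple t) -(card_uniqP ut) max_card.
case: (ex_maxnP ex0 bnd) => k /existsP [t /and3P [tS ut st]] kmax.
have k1 : (0 < k)%N by apply: kmax; apply/existsP; exists [tuple x0]; rewrite /= x0S.
case: k t tS ut st kmax k1 => [//|k] t tS ut st kmax _.
case/tupleP: t tS ut st => v p /=.
move=> /andP [vS pS] /andP [vp up] st.
have hd : exists2 w, w \in [set w in S | sym_rel e v w] & w != head v p.
  by apply: card_gt1_other; apply: deg.
case: hd => w; rewrite inE => /andP [wS vw] wh.
have wv : w != v by apply: contraTneq vw => ->; rewrite /= irr.
have wp : w \in val p.
  apply/negPn/negP => wp.
  suff /kmax : good k.+2 by rewrite ltnn.
  apply/existsP; exists [tuple of w :: v :: p].
  apply/and3P; split; first by rewrite /= wS vS.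
    by rewrite /= inE negb_or wv wp vp up.
  by rewrite /= orbC; apply/andP; split.
case: {kmax} p pS vp up st wh wp => p /= _ pS vp up st wh wp.
case/splitPr: wp pS vp up st wh => p1 p2.
rewrite all_cat => /andP [p1S /= /andP[_ _]].
rewrite mem_cat inE !negb_or => /and3P [vp1 _ _].
rewrite cat_uniq /= negb_or => /and3P [up1 /andP[wp1 _] _].
rewrite cat_path /= => /and3P [pp1 lw _].
(* If [p1] were empty, [w] would be the successor of [v], which was excluded; so the closed walk has
   at least three vertices. *)
case: p1 p1S vp1 up1 wp1 pp1 lw => [|a p1] p1S vp1 up1 wp1 pp1 lw; first by rewrite /= eqxx.
move=> _; exists (v :: rcons (a :: p1) w); split.
- apply/andP; split.
    rewrite /cycle rcons_path rcons_path pp1 last_rcons [sym_rel e w v]sym_relC vw andbT.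
    exact: lw.
  rewrite cons_uniq rcons_uniq mem_rcons inE negb_or eq_sym wv vp1 up1.
  by rewrite wp1.
- by rewrite /= size_rcons.
- move=> z; rewrite inE mem_rcons inE => /or3P [/eqP->|/eqP->|zp] //.
  by move/allP: p1S; apply.
Qed.

(** Every arc lost with [v] is charged to its other end. Asymmetry makes this injective, since an
    arc into [v] and one out of [v] cannot share that end. *)
Lemma arcs_in_le (I : finType) (e : rel I) (S : {set I}) (v : I) :
  irreflexive e -> (forall i j, e i j -> ~~ e j i) ->
  v \in S -> (arcs_in e S <= arcs_in e (S :\ v) + degree_in e S v)%N.
Proof.
move=> irr asym vS; rewrite /arcs_in /degree_in.
pose A := [set p : I * I | [&& p.1 \in S, p.2 \in S & e p.1 p.2]].
pose B := [set p : I * I | [&& p.1 \in S :\ v, p.2 \in S :\ v & e p.1 p.2]].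
rewrite -/A -/B.
pose f (p : I * I) := if p.1 == v then p.2 else p.1.
rewrite -(cardsID B A) leq_add //; first by rewrite subset_leq_card // subsetIr.
have fAB i j : (i, j) \in A :\: B ->
    [/\ i \in S, j \in S, e i j & (i == v) || (j == v)].
  rewrite !inE /= => /andP [nB /and3P [iS jS eij]]; split=> //.
  by move: nB; rewrite iS jS eij !andbT negb_and !negbK.
rewrite -(@card_in_imset _ _ f (A :\: B)).
  apply: subset_leq_card; apply/subsetP => _ /imsetP [[i j] /fAB [iS jS eij ijv] ->].
  rewrite inE /f /=; case: eqVneq ijv => [<-|iv] /=; first by rewrite jS eij.
  by move=> /eqP <-; rewrite iS eij orbT.
move=> [i j] [i' j'] /fAB [iS jS eij ijv] /fAB [iS' jS' eij' ijv']; rewrite /f /=.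
move: ijv ijv' eij eij'.
case: (eqVneq i v) => [->|iv]; case: (eqVneq i' v) => [->|iv'] //=.
- by move=> _ _ _ _ ->.
- by move=> _ /eqP -> + + ji => /asym; rewrite ji => /negbTE->.
- by move=> /eqP -> _ + + ij => /asym; rewrite ij => /negbTE->.
- by move=> /eqP -> /eqP -> _ _ ->.
Qed.

(** Without a cycle some vertex has degree at most one; delete it and induct. *)
Lemma arcs_in_forest (I : finType) (e : rel I) (S : {set I}) :
  irreflexive e -> (forall i j, e i j -> ~~ e j i) ->
  (forall c, ucycle (sym_rel e) c -> (2 < size c)%N -> ~ {subset c <= S}) ->
  S != set0 -> (arcs_in e S < #|S|)%N.
Proof.
move=> irr asym; elim: {S}#|S| {-2}S (erefl #|S|) => [|k IH] S cS acy S0.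
  by move/eqP: cS S0; rewrite cards_eq0 => ->.
have [/forallP allv|/forallPn [v]] :=
  boolP [forall v, (v \in S) ==> (1 < degree_in e S v)%N].
  have [|c [uc sc cS']] := cycle_of_degree_gt1 irr S0.
    by move=> v vS; move/implyP: (allv v); apply.
  by case: (acy c uc sc).
rewrite negb_imply -leqNgt => /andP [vS degv].
have cSv : #|S :\ v| = k by move: (cardsD1 v S); rewrite vS cS => /= -[].
have le := arcs_in_le irr asym vS.
have [Sv0|Sv0] := eqVneq (S :\ v) set0.
  have SE : S = [set v] by rewrite -(setD1K vS) Sv0 setU0.
  rewrite SE cards1 ltnS leqn0 cards_eq0; apply/eqP/setP => -[i j].
  rewrite !inE /=; apply/negP => /and3P [/eqP-> /eqP->]; by rewrite irr.
have lt : (arcs_in e (S :\ v) < k)%N.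
  have /(_ cSv) := IH (S :\ v); rewrite cSv; apply => // c uc sc sub.
  by apply: (acy c uc sc) => z /sub; rewrite !inE => /andP [].
by rewrite cS; lia.
Qed.

Lemma next_neq_prev (T : eqType) (c : seq T) (v : T) :
  uniq c -> (2 < size c)%N -> v \in c -> next c v != prev c v.
Proof.
move=> uc sc vc; apply/eqP => np.
have nn : next c (next c v) = v by rewrite np next_prev.
case/rot_to: vc nn => i s def_s; rewrite -!(next_rot i uc) def_s.
have : (2 < size (rot i c))%N by rewrite size_rot.
have : uniq (rot i c) by rewrite rot_uniq.
rewrite def_s; case: s {def_s} => [//|x [//|y s]] /= /and3P [+ + _] _.
rewrite !inE !negb_or !eqxx => /and3P [vx vy _] /andP [xy _].
by rewrite eq_sym (negbTE vx) => yv; rewrite yv eqxx in vy.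
Qed.

(** * Cycles of a contact digraph and the signed sums they produce *)

Definition unbalanced (F : realFieldType) (I : finType) (r : I -> F) : Prop :=
  forall sigma : I -> int,
    (forall i, sigma i \in [:: -1; 0; 1]) ->
    (4 <= #|[set i | sigma i == 0]|)%N ->
    \sum_i (sigma i)%:~R * r i = 0 ->
    forall i, sigma i = 0.

(** This is what the counting needs of the contacts in one direction. The second field excludes
    cycles in which every vertex turns; phrased for sets, it applies to the vertices of a cycle and
    to four explicit vertices alike. *)
Record contact_digraph (F : realFieldType) (I : finType) (r X : I -> F) (e : rel I) : Prop :=
  ContactDigraph {
    arc_dist : forall i j, e i j -> X j = X i + r i + r j;
    no_turning_set : forall S : {set I}, S != set0 ->
      ~ (forall v, v \in S -> exists a b,
           [/\ a \in S, b \in S, a != b & (e v a && e v b) || (e a v && e b v)])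
  }.

Lemma arc_irr (F : realFieldType) (I : finType) (r X : I -> F) (e : rel I) :
  (forall i, 0 < r i) -> contact_digraph r X e -> irreflexive e.
Proof.
move=> r0 G i; apply/negP => /(arc_dist G); have := r0 i; lra.
Qed.

Lemma arc_asym (F : realFieldType) (I : finType) (r X : I -> F) (e : rel I) :
  (forall i, 0 < r i) -> contact_digraph r X e -> forall i j, e i j -> ~~ e j i.
Proof.
move=> r0 G i j /(arc_dist G) ij; apply/negP => /(arc_dist G).
have := r0 i; have := r0 j; lra.
Qed.

Lemma cycle_structure (F : realFieldType) (I : finType) (r X : I -> F) (e : rel I)
    (c : seq I) :
  (forall i, 0 < r i) -> contact_digraph r X e -> unbalanced r ->
  ucycle (sym_rel e) c -> (2 < size c)%N ->
  (#|I| <= (size c).+1)%N /\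
  exists A B, [/\ A \in c, B \in c, A != B,
    [/\ e A (next c A), e A (prev c A), e (next c B) B & e (prev c B) B] &
    forall v, v \in c -> v != A -> v != B ->
      e (prev c v) v && e v (next c v) || e (next c v) v && e v (prev c v)].
Proof.
move=> r0 G nw /andP [cyc uc] sc.
have irr := arc_irr r0 G; have asym := arc_asym r0 G.
(* Off [c] both [next] and [prev] are the identity, so [n] and [p] are inverse permutations of all
   of [I] and sums over [I] can be reindexed along them. *)
pose n := next c; pose p := prev c; pose up v := e v (n v).
have pn : cancel n p by exact: prev_next.
have np : cancel p n by exact: next_prev.
have nc v : (n v \in c) = (v \in c) by exact: mem_next.
have pc v : (p v \in c) = (v \in c) by exact: mem_prev.
have out v : v \notin c -> n v = v by rewrite /n next_nth => /negbTE->.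
have upN v : v \in c -> e (n v) v = ~~ up v.
  move=> vc; move: (next_cycle cyc vc) => /=; rewrite -/n /up.
  by case: (boolP (e v (n v))) => [/asym/negbTE->|_ /= ->].
have upp v : e (p v) v = up (p v) by rewrite /up np.
have downp v : v \in c -> e v (p v) = ~~ up (p v) by rewrite -pc => /upN; rewrite np.
pose d v : int := if v \in c then (if up v then 1 else -1) else 0.
pose turn v := (v \in c) && (up v != up (p v)).
(* The average of the directions of the two cycle edges at [v]: a sign where the cycle passes
   through, zero at a turning point and off the cycle. *)
pose s v : int := if (v \in c) && (up v == up (p v)) then (if up v then 1 else -1) else 0.
have s2 v : (s v)%:~R *+ 2 = (d v)%:~R + (d (p v))%:~R :> F.
  rewrite /s /d pc; case: (v \in c) => /=; last by rewrite mul0rn addr0.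
  by case: (up v); case: (up (p v)) => /=; rewrite ?mulr2n //=; ring.
have Xn v : X (n v) - X v = (d v)%:~R * (r v + r (n v)).
  rewrite /d; case: (boolP (v \in c)) => [vc|/out ->]; last by rewrite subrr mul0r.
  case: (boolP (up v)) => [/(arc_dist G)->|]; first by ring.
  by rewrite -upN // => /(arc_dist G)->; ring.
(* The steps [X (n v) - X v] sum to zero; collecting the coefficient of each [r v] gives twice the
   signed sum. *)
have sum0 : \sum_v (s v)%:~R * r v = 0.
  have : \sum_v (X (n v) - X v) = 0.
    rewrite sumrB [X in X - _](_ : _ = \sum_v X v) ?subrr //.
    by rewrite [RHS](reindex_inj (can_inj pn)).
  rewrite (eq_bigr _ (fun v _ => Xn v)).
  under eq_bigr do rewrite mulrDr.
  rewrite big_split /= [X in _ + X](reindex_inj (can_inj np)) /= -big_split /=.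
  under eq_bigr do rewrite np -mulrDl -s2 mulrnAl.
  by rewrite sumrMnl => /eqP; rewrite mulrn_eq0 /= => /eqP.
have sP i : s i \in [:: -1; 0; 1].
  by rewrite /s; case: ifP => _; [case: (up i)|].
pose T := [set v | turn v].
have zE : [set i | s i == 0] = T :|: ~: [set v in c].
  apply/setP => v; rewrite !inE /s /turn; case: (v \in c) => //=.
  by case: (up v); case: (up (p v)).
have cc : #|[set v in c]| = size c by rewrite cardsE; apply/card_uniqP.
have zc : #|[set i | s i == 0]| = (#|T| + (#|I| - size c))%N.
  rewrite zE cardsU [#|~: _|]cardsCs setCK cc [X in (_ - X)%N](_ : _ = 0)%N ?subn0 //.
  by apply/eqP; rewrite cards_eq0; apply/eqP/setP => v; rewrite !inE /turn; case: (v \in c); rewrite ?andbF.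
(* With four zeros [s] would vanish, so every vertex of [c] would turn, against [no_turning_set]. *)
have lt4 : (#|T| + (#|I| - size c) < 4)%N.
  rewrite ltnNge -zc; apply/negP => z4.
  have s0 := nw s sP z4 sum0.
  apply: (no_turning_set G (S := [set v in c])).
    by apply/set0Pn; case: (c) sc => // a l _; exists a; rewrite inE mem_head.
  move=> v; rewrite inE => vc; exists (n v), (p v).
  rewrite !inE nc pc vc next_neq_prev //; split=> //.
  move: (s0 v); rewrite /s vc /= upp upN // downp //= -/(up v).
  by case: (up v); case: (up (p v)).
(* Modulo 2, the number of turns is the sum of [up v (+) up (p v)], in which each [up v] occurs
   twice. *)
have Tev : ~~ odd #|T|.
  have -> : #|T| = (\sum_(v in c) (up v != up (p v)))%N.
    rewrite -sum1_card big_mkcond [RHS]big_mkcond; apply: eq_bigr => v _.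
    by rewrite inE /turn; case: (v \in c) => //=; case: (up v == _).
  rewrite (big_morph odd oddD (erefl : odd 0 = false)).
  under eq_bigr => v _ do rewrite oddb negb_eqb.
  rewrite big_split /= [X in X (+) _](reindex_inj (can_inj np)) /=.
  by under eq_bigl do rewrite pc; rewrite addbb.
have [x0 x0c] : exists x, x \in c.
  by case: (c) sc => // a l _; exists a; rewrite mem_head.
(* The vertices with least and greatest centre are turning points; by parity and the bound below
   four there are no others. *)
have [A Ac Amin] : exists2 A, A \in c & forall v, v \in c -> X A <= X v.
  by case: (Order.TotalTheory.arg_minP X (P := mem c) x0c) => A Ac Amin; exists A.
have [B Bc Bmax] : exists2 B, B \in c & forall v, v \in c -> X v <= X B.
  by case: (Order.TotalTheory.arg_maxP X (P := mem c) x0c) => B Bc Bmax; exists B.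
have elt i j : e i j -> X i < X j.
  by move=> /(arc_dist G) ->; have := r0 i; have := r0 j; lra.
have upA : up A.
  by rewrite -[up A]negbK -upN //; apply/negP => /elt; rewrite ltNge Amin // nc.
have uppA : ~~ up (p A).
  by rewrite -upp //; apply/negP => /elt; rewrite ltNge Amin // pc.
have upB : ~~ up B.
  by apply/negP => /elt; rewrite ltNge Bmax // nc.
have uppB : up (p B).
  rewrite -[up _]negbK -downp //; apply/negP => /elt; rewrite ltNge Bmax // pc //.
have AB : A != B by apply: contraTneq upA => ->.
have ABT : [set A; B] \subset T.
  apply/subsetP => v; rewrite !inE /turn => /orP [] /eqP ->.
    by rewrite Ac upA (negbTE uppA).
  by rewrite Bc uppB (negbTE upB).
have T2 : (1 < #|T|)%N by have := subset_leq_card ABT; rewrite cards2 AB.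
have cT : #|T| = 2%N by move: lt4 Tev T2; case: #|T| => [|[|[|[|k]]]] //; lia.
have TE : T = [set A; B] by apply/esym/eqP; rewrite eqEcard ABT cards2 AB cT.
split; first by lia.
exists A, B; split=> //.
  by rewrite -/(n A) -/(p A) -/(n B) -/(p B) upp downp // upN // -/(up A) uppA upB.
move=> v vc vA vB.
have : v \notin T by rewrite TE !inE negb_or vA.
rewrite inE /turn vc /= negbK -/(n v) -/(p v) upp downp // upN // -/(up v) => /eqP->.
by case: (up _).
Qed.

(** Among the vertices other than [A], the one with leftmost left side can only have [A] as
    predecessor, so its left side is the right side of [A]. A vertex attaining equality has no
    predecessor but [A], for any other would begin left of that line. *)
Lemma cycle_source (F : realFieldType) (I : finType) (r X : I -> F) (e : rel I)
    (c : seq I) (A : I) :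
  (forall i, 0 < r i) -> (forall i j, e i j -> X j = X i + r i + r j) -> uniq c ->
  (forall v, v \in c -> v != A -> e (prev c v) v || e (next c v) v) ->
  forall v, v \in c -> v != A ->
    X A + r A <= X v - r v /\
    (X A + r A = X v - r v -> v \in [set next c A; prev c A]).
Proof.
move=> r0 dist uc pred.
have pred' v : v \in c -> v != A ->
    exists w, [/\ w \in c, e w v & w = A -> v \in [set next c A; prev c A]].
  move=> vc vA; case/orP: (pred v vc vA) => ev.
    exists (prev c v); rewrite mem_prev; split=> // <-.
    by rewrite !inE next_prev // eqxx.
  exists (next c v); rewrite mem_next; split=> // <-.
  by rewrite !inE prev_next // eqxx orbT.
have le v : v \in c -> v != A -> X A + r A <= X v - r v.
  move=> vc vA; pose P := [pred z | (z \in c) && (z != A)].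
  have Pv : P v by rewrite /= vc.
  case: (Order.TotalTheory.arg_minP (fun z => X z - r z) Pv) => m /andP [mc mA] mmin.
  apply: le_trans (mmin v Pv).
  have [w [wc /dist ewm _]] := pred' m mc mA.
  have [wA|wA] := eqVneq w A; first by rewrite ewm wA; lra.
  have Pw : P w by rewrite /= wc.
  by have := mmin w Pw; have := r0 w; rewrite ewm; lra.
move=> v vc vA; split=> [|eqv]; first exact: le.
have [w [wc /dist ewv wA]] := pred' v vc vA.
have [/wA //|nwA] := eqVneq w A.
by have := le w wc nwA; have := r0 w; lra.
Qed.

(* Two neighbours of [D] cut the cycle into two arcs; closing up one of them through [D]
   gives a cycle avoiding both ends of any edge of the other arc. *)
Lemma off_cycle_neighbours (I : finType) (e : rel I) (c : seq I) (D w1 w2 a : I) :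
  (forall c', ucycle (sym_rel e) c' -> (2 < size c')%N -> (#|I| <= (size c').+1)%N) ->
  ucycle (sym_rel e) c -> D \notin c -> w1 \in c -> w2 \in c -> w1 != w2 ->
  sym_rel e D w1 -> sym_rel e D w2 -> a \in c ->
  (a \in [set w1; w2]) || (next c a \in [set w1; w2]).
Proof.
move=> big /andP [cyc uc] Dc + + + + + ac; case/rot_to: (ac) => i s def_s.
rewrite -(next_rot i uc) -!(mem_rot i c) def_s.
have : D \notin rot i c by rewrite mem_rot.
have : uniq (rot i c) by rewrite rot_uniq.
have : cycle (sym_rel e) (rot i c) by rewrite rot_cycle.
rewrite {}def_s; case: s => [|b s] cs us Ds; first by rewrite !inE => /eqP->; rewrite eqxx.
have -> : next [:: a, b & s] a = b by rewrite /= eqxx.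
wlog W : w1 w2 / (index w1 s < index w2 s)%N.
  move=> H w1s w2s w12 D1 D2.
  have [|le|eqi] := ltngtP (index w1 s) (index w2 s); first by move=> lt; apply: H.
    by rewrite setUC; apply: H; rewrite // eq_sym.
  move: w1s w2s; rewrite !inE.
  case: (w1 =P a) => [->|_]; first by rewrite eqxx.
  case: (w1 =P b) => [->|_]; first by rewrite eqxx !orbT.
  move=> /= w1s; case: (w2 =P a) => [->|_]; first by rewrite eqxx orbT.
  case: (w2 =P b) => [->|_]; first by rewrite eqxx !orbT.
  move=> /= w2s; move: w12.
  by rewrite -(nth_index a w1s) -(nth_index a w2s) eqi eqxx.
move=> w1s w2s w12 D1 D2; apply/negPn/negP.
rewrite !inE !negb_or => /andP [/andP [aw1 aw2] /andP [bw1 bw2]].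
move: w1s w2s; rewrite !inE ![_ == a]eq_sym ![_ == b]eq_sym.
rewrite (negbTE aw1) (negbTE aw2) (negbTE bw1) (negbTE bw2) /= => w1s w2s.
case/splitPr: w1s W w2s cs us Ds => p1 p2 W w2s cs us Ds.
have w2p : w2 \in p2.
  move: w2s; rewrite mem_cat inE [w2 == w1]eq_sym (negbTE w12) /= => /orP [w2p1|//].
  move: W; rewrite !index_cat w2p1; case: ifP => _; last first.
    by rewrite /= eqxx addn0 ltnNge ltnW // index_mem.
  have w1p : w1 \notin p1.
    by move: us; rewrite /= cat_uniq /= negb_or => /and5P [_ _ _ /andP [-> _] _].
  by rewrite (memNindex w1p) ltnNge ltnW // index_mem.
case/splitPr: w2p W w2s cs us Ds => p3 p4 _ _ cs us Ds.
pose l := p1 ++ w1 :: p3 ++ w2 :: p4; rewrite -/l in cs us Ds.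
have uD : uniq (D :: [:: a, b & l]) by rewrite cons_uniq Ds.
(* This cycle misses both [a] and [b], so it has at most [#|I| - 2] vertices, contrary to [big]. *)
pose c' := D :: w1 :: rcons p3 w2.
have lE : l = p1 ++ (w1 :: rcons p3 w2) ++ p4 by rewrite /l /= cat_rcons.
have uc' : uniq c'.
  have sub : subseq c' ([:: D] ++ ([:: a, b & p1] ++ ((w1 :: rcons p3 w2) ++ p4))).
    rewrite -[c']/([:: D] ++ _) cat_subseq ?subseq_refl //.
    exact: subseq_trans (prefix_subseq _ p4) (suffix_subseq [:: a, b & p1] _).
  by apply: (subseq_uniq sub); move: uD; rewrite lE.
have cc' : cycle (sym_rel e) c'.
  move: cs; rewrite /cycle lE rcons_path => /andP [+ _].
  rewrite -[b :: _]/((b :: p1) ++ _) !cat_path => /and3P [_ + _].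
  rewrite /= -/(sym_rel e D w1) => /andP [_ pw].
  by rewrite rcons_path pw last_rcons D1 /= orbC.
have := big c'; rewrite /ucycle cc' uc' => /(_ isT).
have : (size (D :: [:: a, b & l]) <= #|I|)%N by rewrite -(card_uniqP uD) max_card.
rewrite lE /c' /= size_cat /= size_cat !size_rcons.
by move: (size p1) (size p3) (size p4) #|I|; clear; lia.
Qed.

(** * Arc counts in the presence of a cycle *)

Lemma degree_in_subset (I : finType) (e : rel I) (S T : {set I}) (v : I) :
  S \subset T -> (degree_in e S v <= degree_in e T v)%N.
Proof.
move=> ST; apply: subset_leq_card; apply/subsetP => w.
by rewrite !inE => /andP [/(subsetP ST) -> ->].
Qed.

(** A cycle misses at most one vertex, so deleting two vertices leaves a forest. *)
Lemma arcs_off_pair (F : realFieldType) (I : finType) (r X : I -> F) (e : rel I) (a b : I) :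
  (forall i, 0 < r i) -> contact_digraph r X e -> unbalanced r ->
  a != b -> (2 < #|I|)%N -> (arcs_in e (setT :\ a :\ b) <= #|I| - 3)%N.
Proof.
move=> r0 G nw ab n2.
have cS : #|setT :\ a :\ b| = (#|I| - 2)%N.
  have := cardsD1 a (setT : {set I}); rewrite inE cardsT.
  by have := cardsD1 b (setT :\ a); rewrite !inE eq_sym ab /= => -> ->; rewrite addnA addKn.
have : (arcs_in e (setT :\ a :\ b) < #|setT :\ a :\ b|)%N.
  apply: arcs_in_forest; [exact: arc_irr r0 G|exact: arc_asym r0 G| |]; last first.
    by rewrite -card_gt0 cS subn_gt0.
  move=> c cc sc sub; have [+ _] := cycle_structure r0 G nw cc sc.
  case/andP: cc => _ uc; have : (size c <= #|setT :\ a :\ b|)%N.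
    by rewrite -(card_uniqP uc); apply: subset_leq_card; apply/subsetP.
  by rewrite cS; move: (size c) #|I| n2; clear; lia.
by rewrite cS; move: (arcs_in _ _) #|I| n2; clear; lia.
Qed.

Lemma arcs_drop_pair (F : realFieldType) (I : finType) (r X : I -> F) (e : rel I) (a b : I) :
  (forall i, 0 < r i) -> contact_digraph r X e -> unbalanced r ->
  a != b -> (2 < #|I|)%N ->
  (arcs_in e setT <= (#|I| - 3) + degree_in e setT a + degree_in e (setT :\ a) b)%N.
Proof.
move=> r0 G nw ab n2.
have off := arcs_off_pair r0 G nw ab n2.
have irr := arc_irr r0 G; have asym := arc_asym r0 G.
have aT : a \in setT by rewrite inE.
have bT : b \in setT :\ a by rewrite !inE eq_sym ab.
have := leq_add (arcs_in_le irr asym bT) (leq_add (arcs_in_le irr asym aT) off).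
move: (arcs_in _ _) (arcs_in _ _) (arcs_in _ _) (degree_in _ _ _) (degree_in _ _ _).
by clear; lia.
Qed.

(** By [off_cycle_neighbours] the pair [w1], [w2] meets every edge of the cycle. If it omits [A] it
    consists of the two cycle neighbours of [A], and likewise for [B]; as there is no arc from [A]
    to [B], it contains both or neither. In the latter case [w1] and [w2] follow [A] and precede
    [B]. *)
Lemma neighbours_off_cycle (F : realFieldType) (I : finType) (r X : I -> F) (e : rel I)
    (c : seq I) (A B D w1 w2 : I) :
  (forall i, 0 < r i) -> contact_digraph r X e ->
  (forall c', ucycle (sym_rel e) c' -> (2 < size c')%N -> (#|I| <= (size c').+1)%N) ->
  ucycle (sym_rel e) c -> (2 < size c)%N -> A \in c -> B \in c -> A != B -> ~~ e A B ->
  [/\ e A (next c A), e A (prev c A), e (next c B) B & e (prev c B) B] ->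
  D \notin c -> w1 \in c -> w2 \in c -> w1 != w2 ->
  sym_rel e D w1 -> sym_rel e D w2 ->
  [set w1; w2] = [set A; B].
Proof.
move=> r0 G big cc sc Ac Bc AB nAB [An Ap nB pB] Dc w1c w2c w12 D1 D2.
have uc : uniq c by case/andP: cc.
have cov a ac := @off_cycle_neighbours _ _ _ _ _ _ a big cc Dc w1c w2c w12 D1 D2 ac.
have cA := cov A Ac; have cB := cov B Bc.
have := cov (prev c A); rewrite mem_prev next_prev // => /(_ Ac) cA'.
have := cov (prev c B); rewrite mem_prev next_prev // => /(_ Bc) cB'.
have nA : next c A != prev c A by apply: next_neq_prev.
have nBp : next c B != prev c B by apply: next_neq_prev.
have c2 : #|[set w1; w2]| = 2%N by rewrite cards2 w12.
have pairE x y : x != y -> x \in [set w1; w2] -> y \in [set w1; w2] -> [set w1; w2] = [set x; y].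
  move=> xy xw yw; apply/esym/eqP; rewrite eqEcard c2 cards2 xy andbT.
  by apply/subsetP => z; rewrite !inE => /orP [] /eqP ->; move: xw yw; rewrite !inE.
case: (boolP (A \in [set w1; w2])) cA cA' => [Aw _ _|Aw /= nAw /[!orbF] pAw].
  case: (boolP (B \in [set w1; w2])) cB cB' => [Bw _ _|Bw /= nBw /[!orbF] pBw].
    exact: pairE.
  by move: Aw; rewrite (pairE _ _ nBp nBw pBw) !inE => /orP [] /eqP AE; case/negP: nAB; rewrite AE.
case: (boolP (B \in [set w1; w2])) cB cB' => [Bw _ _|Bw /= nBw /[!orbF] pBw].
  by move: Bw; rewrite (pairE _ _ nA nAw pAw) !inE => /orP [] /eqP BE; case/negP: nAB; rewrite BE.
have eA w : w \in [set w1; w2] -> e A w.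
  by rewrite (pairE _ _ nA nAw pAw) !inE => /orP [] /eqP ->.
have eB w : w \in [set w1; w2] -> e w B.
  by rewrite (pairE _ _ nBp nBw pBw) !inE => /orP [] /eqP ->.
have A1 : e A w1 by apply: eA; rewrite !inE eqxx.
have A2 : e A w2 by apply: eA; rewrite !inE eqxx orbT.
have B1 : e w1 B by apply: eB; rewrite !inE eqxx.
have B2 : e w2 B by apply: eB; rewrite !inE eqxx orbT.
have DA : D != A by apply: contraNneq Dc => ->.
have DB : D != B by apply: contraNneq Dc => ->.
(* If [D] lies on one side of both [w1] and [w2], then together with [A] or [B] they form a turning
   set. If [D] lies between them, the distances clash, since [w1] and [w2] have their left sides on
   a common line. *)
exfalso; case/orP: D1 => D1; case/orP: D2 => D2.
- apply: (no_turning_set G (S := [set D; A; w1; w2])).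
    by apply/set0Pn; exists D; rewrite !inE eqxx.
  move=> v; rewrite !inE -!orbA => /or4P [] /eqP ->;
    [exists w1, w2|exists w1, w2|exists D, A|exists D, A];
    by rewrite !inE !eqxx ?orbT; split; rewrite // ?D1 ?D2 ?A1 ?A2 ?orbT.
- have := arc_dist G D1; have := arc_dist G D2; have := arc_dist G A1.
  by have := arc_dist G A2; have := r0 w2; have := r0 D; lra.
- have := arc_dist G D1; have := arc_dist G D2; have := arc_dist G A1.
  by have := arc_dist G A2; have := r0 w1; have := r0 D; lra.
- apply: (no_turning_set G (S := [set D; B; w1; w2])).
    by apply/set0Pn; exists D; rewrite !inE eqxx.
  move=> v; rewrite !inE -!orbA => /or4P [] /eqP ->;
    [exists w1, w2|exists w1, w2|exists D, B|exists D, B];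
    by rewrite !inE !eqxx ?orbT; split; rewrite // ?D1 ?D2 ?B1 ?B2 ?orbT.
Qed.

(** By [cycle_source], a neighbour of [A] on the cycle, in either graph, has its left side on the
    line of the right side of [A], hence is one of the two cycle neighbours. These are already
    joined to [A] by [e], so not by [g]. *)
Lemma cycle_source_degrees (F : realFieldType) (I : finType) (r X : I -> F) (e g : rel I)
    (c : seq I) (A : I) :
  (forall i, 0 < r i) -> (forall i j, e i j -> X j = X i + r i + r j) -> uniq c ->
  irreflexive g -> (forall i j, sym_rel e i j -> ~~ sym_rel g i j) ->
  (forall i j, sym_rel g i j -> X j <= X i + r i + r j) ->
  e A (next c A) -> e A (prev c A) ->
  (forall v, v \in c -> v != A -> e (prev c v) v || e (next c v) v) ->
  (degree_in e [set v in c] A <= 2)%N /\ degree_in g [set v in c] A = 0%N.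
Proof.
move=> r0 dist uc irrg eg gX An Ap pred.
have src := cycle_source r0 dist uc pred.
have irr : irreflexive e by move=> i; apply/negP => /dist; have := r0 i; lra.
split.
  apply: (@leq_trans #|[set next c A; prev c A]|); last by rewrite cards2; case: (_ != _).
  apply: subset_leq_card; apply/subsetP => w; rewrite inE inE => /andP [wc].
  have [->|wA] := eqVneq w A; first by rewrite /= irr.
  have [le eqw] := src w wc wA.
  case/orP => /dist d; last by have := r0 A; have := r0 w; lra.
  by apply: eqw; lra.
apply/eqP; rewrite cards_eq0; apply/eqP/setP => w; rewrite inE inE in_set0.
apply/negP => /andP [wc gAw].
have [wA|wA] := eqVneq w A; first by move: gAw; rewrite wA /= irrg.
have [le eqw] := src w wc wA.
have : w \in [set next c A; prev c A] by apply: eqw; have := gX _ _ gAw; lra.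
have eAw : e A w -> False by move=> h; move: gAw; apply/negP; apply: eg; rewrite /= h.
by rewrite !inE => /orP [] /eqP wE; apply: eAw; rewrite wE.
Qed.

Lemma degree_in_converse (I : finType) (e : rel I) (S : {set I}) (v : I) :
  degree_in (fun i j => e j i) S v = degree_in e S v.
Proof. by apply: eq_card => w; rewrite !inE /= orbC. Qed.

Lemma degree_in_setT_le (I : finType) (e : rel I) (S : {set I}) (D v : I) :
  (forall w, w \in S \/ w = D) ->
  (degree_in e setT v <= degree_in e S v + sym_rel e v D)%N.
Proof.
move=> SD; have [vD|vD] := boolP (sym_rel e v D).
  rewrite -[nat_of_bool true](cards1 D).
  apply: leq_trans (leq_card_setU _ _); apply: subset_leq_card.
  apply/subsetP => w; rewrite !inE => vw.
  by case: (SD w) => [->|->]; rewrite ?vw ?eqxx ?orbT.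
rewrite addn0; apply: subset_leq_card; apply/subsetP => w; rewrite !inE => vw.
by case: (SD w) => [->|wD]; [rewrite vw|move: vw vD; rewrite wD /= => ->].
Qed.

(** So many arcs force a cycle of [e]. Its extremes [A] and [B] have few neighbours on the cycle in
    both graphs, and deleting two vertices leaves at most [#|I| - 3] arcs in each graph. *)
Lemma arcs_bound_of_dense (F : realFieldType) (I : finType) (r X Y : I -> F) (e g : rel I) :
  (forall i, 0 < r i) -> contact_digraph r X e -> contact_digraph r Y g ->
  (forall i j, sym_rel e i j -> ~~ sym_rel g i j) ->
  (forall i j, sym_rel g i j -> X j <= X i + r i + r j) ->
  unbalanced r -> (0 < #|I|)%N -> (#|I| <= arcs_in e setT)%N ->
  (arcs_in e setT + arcs_in g setT <= 2 * #|I| - 2)%N.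
Proof.
move=> r0 Ge Gg eg gX nw n0 dense.
have irr := arc_irr r0 Ge; have asym := arc_asym r0 Ge; have irrg := arc_irr r0 Gg.
have [c [cc sc]] : exists c, ucycle (sym_rel e) c /\ (2 < size c)%N.
  apply: contrapT => nc.
  have : (arcs_in e setT < #|[set: I]|)%N.
    apply: arcs_in_forest => //; last by rewrite -card_gt0 cardsT.
    by move=> c cc sc _; apply: nc; exists c.
  by rewrite cardsT ltnNge dense.
have big c' cc' sc' := (@cycle_structure _ _ _ _ _ c' r0 Ge nw cc' sc').1.
have [nle [A [B [Ac Bc AB ext thr]]]] := cycle_structure r0 Ge nw cc sc.
have [An Ap nB pB] := ext.
have uc : uniq c by case/andP: cc.
have szc : (size c <= #|I|)%N by rewrite -(card_uniqP uc) max_card.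
have n2 : (2 < #|I|)%N by apply: leq_trans szc.
have prd v : v \in c -> v != A -> e (prev c v) v || e (next c v) v.
  move=> vc vA; have [->|vB] := eqVneq v B; first by rewrite pB.
  by case/orP: (thr v vc vA vB) => /andP [-> _]; rewrite ?orbT.
have suc v : v \in c -> v != B -> e v (prev c v) || e v (next c v).
  move=> vc vB; have [->|vA] := eqVneq v A; first by rewrite Ap.
  by case/orP: (thr v vc vA vB) => /andP [_ ->]; rewrite ?orbT.
have srcA := cycle_source r0 (arc_dist Ge) uc prd.
(* Reflecting the axis and reversing the arcs turns the sink [B] into a source. *)
have dist' i j : e j i -> - X j = - X i + r i + r j by move=> /(arc_dist Ge) ->; lra.
have srcB := @cycle_source _ _ _ (fun i => - X i) (fun i j => e j i) c B r0 dist' uc suc.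
(* Another predecessor [w] of [B] on the cycle would end where [A] ends, yet it begins no earlier
   than that. *)
have nAB : ~~ e A B.
  apply/negP => /(arc_dist Ge) dAB.
  have [w [wc wB wA]] : exists w, [/\ w \in c, e w B & w != A].
    have [nA|nA] := eqVneq (next c B) A; last by exists (next c B); rewrite mem_next.
    by exists (prev c B); rewrite mem_prev -nA eq_sym next_neq_prev.
  have [le _] := srcA w wc wA; have := arc_dist Ge wB; have := r0 w; lra.
have [dxA dyA] := cycle_source_degrees r0 (arc_dist Ge) uc irrg eg gX An Ap prd.
have [] := @cycle_source_degrees _ _ r (fun i => - X i) (fun i j => e j i) g c B r0 dist' uc
  irrg _ _ nB pB suc.
- by move=> i j; rewrite /= orbC; apply: eg.
- by move=> i j; rewrite sym_relC => /gX; lra.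
rewrite degree_in_converse => dxB dyB.
set S := [set v in c] in dxA dyA dxB dyB.
have leA := arcs_drop_pair r0 Ge nw AB n2.
have lgA := arcs_drop_pair r0 Gg nw AB n2.
have sub1 : setT :\ A \subset setT := subsetT _.
have lxB := degree_in_subset e B sub1.
have lyB := degree_in_subset g B sub1.
(* If the cycle spans [I], removing [A] and [B] costs at most four arcs of [e] and none of [g]. *)
have [ST|] := boolP ([forall v, v \in c]).
  have SE : S = setT by apply/setP => v; rewrite !inE (forallP ST).
  move: dxA dyA dxB dyB; rewrite SE => dxA dyA dxB dyB.
  rewrite dyA in lgA; rewrite dyB in lyB.
  move: dxA dxB leA lgA lxB lyB n2; clear.
  move: (arcs_in e _) (arcs_in g _) (degree_in e _ A) (degree_in e setT B) (degree_in e _ B)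
    (degree_in g _ B) #|I|.
  by lia.
rewrite negb_forall => /existsP [D Dc].
have cD w : w \in S \/ w = D.
  rewrite inE; have [wc|wc] := boolP (w \in c); [by left|right].
  apply: contrapT => /eqP wD.
  have uD : uniq [:: w, D & c] by rewrite /= inE negb_or wD wc Dc.
  have : (size [:: w, D & c] <= #|I|)%N by rewrite -(card_uniqP uD) max_card.
  by move=> /= h; move: (leq_trans h nle); rewrite ltnn.
have dgA := degree_in_setT_le g A cD; rewrite dyA add0n in dgA.
have dgB := degree_in_setT_le g B cD; rewrite dyB add0n in dgB.
(* Two [e]-neighbours of [D] must be [A] and [B], which then are not [g]-neighbours. Otherwise only
   the case where both [A] and [B] are [g]-neighbours needs an argument. *)
have key : (degree_in e setT D + sym_rel g A D + sym_rel g B D <= 2)%N.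
  have nbr w : sym_rel e D w -> w \in c.
    by case: (cD w) => [|->]; rewrite ?inE // /= irr.
  have pair w1 w2 : w1 != w2 -> sym_rel e D w1 -> sym_rel e D w2 -> [set w1; w2] = [set A; B].
    move=> w12 D1 D2.
    exact: (neighbours_off_cycle r0 Ge big cc sc Ac Bc AB nAB ext Dc (nbr _ D1) (nbr _ D2)).
  have [d1|] := leqP (degree_in e setT D) 1; last first.
    move=> /card_gt1P [w1 [w2 []]]; rewrite inE in_setT => D1; rewrite inE in_setT => D2 w12.
    have wAB := pair w1 w2 w12 D1 D2.
    have DAB w : w \in [set A; B] -> sym_rel e D w by rewrite -wAB !inE => /orP [] /eqP ->.
    have DA : sym_rel e D A by apply: DAB; rewrite !inE eqxx.
    have DB : sym_rel e D B by apply: DAB; rewrite !inE eqxx orbT.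
    rewrite (sym_relC g A) (sym_relC g B) (negbTE (eg _ _ DA)) (negbTE (eg _ _ DB)) !addn0.
    rewrite (_ : 2%N = #|[set A; B]|); last by rewrite cards2 AB.
    apply: subset_leq_card; apply/subsetP => w; rewrite inE in_setT => Dw.
    have [->|wA] := eqVneq w A; first by rewrite !inE eqxx.
    by rewrite -(pair w A) // !inE eqxx.
  have [gAD|_] := boolP (sym_rel g A D); last first.
    by move: d1; rewrite addn0; case: (sym_rel g B D); move: (degree_in e setT D); clear; lia.
  have [gBD|_] := boolP (sym_rel g B D); last first.
    by move: d1; move: (degree_in e setT D); clear; lia.
  suff -> : degree_in e setT D = 0%N by [].
  apply/eqP; rewrite cards_eq0; apply/eqP/setP => w; rewrite inE in_setT in_set0.
  apply/negP => Dw; have wc := nbr _ Dw.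
  have wA : w != A.
    by apply: contraTneq Dw => ->; apply/negP => /eg; rewrite sym_relC gAD.
  have wB : w != B.
    by apply: contraTneq Dw => ->; apply/negP => /eg; rewrite sym_relC gBD.
  (* The extent of [w] lies between [A] and [B], hence inside that of [D], whereas an [e]-arc lets
     the extents share only an endpoint. *)
  have [leA' _] := srcA w wc wA; have [leB' _] := srcB w wc wB.
  have g1 := gX _ _ gAD; have := gX D B; rewrite sym_relC => /(_ gBD) g2.
  by case/orP: Dw => /(arc_dist Ge) d; have := r0 w; lra.
(* For [e] the deleted pair is [D] and [A], for [g] it is [A] and [B]; [key] bounds the sum of the
   terms involving [D]. *)
have lx : (arcs_in e setT <= (#|I| - 3) + degree_in e setT D + 2)%N.
  have DA : D != A by apply: contraNneq Dc => ->.
  apply: leq_trans (arcs_drop_pair r0 Ge nw DA n2) _; rewrite leq_add2l.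
  apply: leq_trans dxA; apply: degree_in_subset; apply/subsetP => w.
  by rewrite !inE andbT => wD; case: (cD w) => [|wE]; [rewrite inE|rewrite wE eqxx in wD].
move: key lx lgA lyB dgA dgB n2; clear.
move: (sym_rel g A D : nat) (sym_rel g B D : nat).
move: (arcs_in e _) (arcs_in g _) (degree_in g _ A) (degree_in g setT B) (degree_in e _ D)
    (degree_in g _ B) #|I|.
by lia.
Qed.

(** * Contacts of squares as arcs in two directions *)

(* A horizontal contact, [i] left of [j]; the corner contact with [j] to the lower right of [i]
   is left out, since it is a vertical contact [harc r Y (\- X) j i]. *)
Definition harc (F : realFieldType) (I : finType) (r X Y : I -> F) : rel I := fun i j =>
  [&& X j - X i == r i + r j, - (r i + r j) < Y j - Y i & Y j - Y i <= r i + r j].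

Definition separated (F : realFieldType) (I : finType) (r X Y : I -> F) : Prop :=
  forall i j, i != j -> r i + r j <= `|X i - X j| \/ r i + r j <= `|Y i - Y j|.

Lemma harcP (F : realFieldType) (I : finType) (r X Y : I -> F) i j :
  reflect [/\ X j - X i = r i + r j, - (r i + r j) < Y j - Y i & Y j - Y i <= r i + r j]
          (harc r X Y i j).
Proof.
by apply: (iffP and3P) => -[/eqP ? ? ?]; split=> //; apply/eqP.
Qed.

(* Among the squares of lowest top side in a turning set, take the rightmost one. *)
Lemma harc_digraph (F : realFieldType) (I : finType) (r X Y : I -> F) :
  (forall i, 0 < r i) -> separated r X Y -> contact_digraph r X (harc r X Y).
Proof.
move=> r0 sep; split=> [i j /harcP [d _ _]|S /set0Pn [x0 x0S] turn]; first by lra.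
pose top v := Y v + r v.
have [m mS mmin] : exists2 m, m \in S & forall v, v \in S -> top m <= top v.
  by case: (Order.TotalTheory.arg_minP top (P := mem S) x0S) => m mS mmin; exists m.
pose P := [pred v | (v \in S) && (top v == top m)].
have Pm : P m by rewrite /= mS eqxx.
case: (Order.TotalTheory.arg_maxP X Pm) => u /andP [uS /eqP utop] umax.
have [a [b [aS bS ab]]] := turn u uS.
have sepx i j : i != j -> `|X i - X j| < r i + r j ->
    Y i + r i <= Y j - r j \/ Y j + r j <= Y i - r i.
  move=> ij lt; case: (sep i j ij) => [|]; first by rewrite leNgt lt.
  by rewrite ler_normr => /orP [] ?; [right|left]; lra.
have ua := mmin a aS; have ub := mmin b bS; rewrite -utop in ua ub.
have ra := r0 a; have rb := r0 b; have ru := r0 u.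
case/orP => /andP [/harcP [da la ha] /harcP [db lb hb]].
  (* Two right neighbours: the lower one has its top no higher than that of [u], hence level with
     it, but lies further right. *)
  have ov : `|X a - X b| < r a + r b by rewrite ltr_norml; apply/andP; split; lra.
  suff [w [wS wtop wX]] : exists w, [/\ w \in S, top w = top u & X u < X w].
    by have := umax w; rewrite /= wS wtop utop eqxx => /(_ isT); rewrite leNgt wX.
  rewrite /top in ua ub *.
  by case: (sepx a b ab ov) => h; [exists a|exists b]; split=> //; lra.
(* Two left neighbours: the corner convention makes the bound strict, so the lower one has its top
   below that of [u]. *)
have ov : `|X a - X b| < r a + r b by rewrite ltr_norml; apply/andP; split; lra.
rewrite /top in ua ub.
by case: (sepx a b ab ov) => h; lra.
Qed.

(** The quarter turn from [(X, Y)] to [(Y, - X)] lets the results on horizontal contacts serve for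
    vertical ones. *)
Lemma separated_rot (F : realFieldType) (I : finType) (r X Y : I -> F) :
  separated r X Y -> separated r Y (\- X).
Proof.
move=> sep i j ij; case: (sep i j ij) => h; [right|by left].
by rewrite /= -opprD normrN.
Qed.

(** Some coordinate difference equals the sum of the radii. It yields an arc in that direction,
    except at the corner excluded there, where the other direction supplies the arc. *)
Lemma contact_arc (F : realFieldType) (I : finType) (r X Y : I -> F) (i j : I) :
  (forall i, 0 < r i) -> separated r X Y -> i != j ->
  `|X i - X j| <= r i + r j -> `|Y i - Y j| <= r i + r j ->
  sym_rel (harc r X Y) i j || sym_rel (harc r Y (\- X)) i j.
Proof.
move=> r0 sep ij; have ri := r0 i; have rj := r0 j; rewrite !ler_norml => /andP [x1 x2] /andP [y1 y2].
have : [\/ X i - X j = r i + r j, X j - X i = r i + r j, Y i - Y j = r i + r j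
         | Y j - Y i = r i + r j].
  case: (sep i j ij); rewrite ler_normr => /orP [] h.
  - by constructor 1; lra.
  - by constructor 2; lra.
  - by constructor 3; lra.
  - by constructor 4; lra.
rewrite /sym_rel; case=> h.
- have [lt|le] := ltP (- (r i + r j)) (Y i - Y j).
    by apply/orP; left; apply/orP; right; apply/harcP; split; lra.
  by apply/orP; right; apply/orP; left; apply/harcP; split; rewrite /=; lra.
- have [lt|le] := ltP (- (r i + r j)) (Y j - Y i).
    by apply/orP; left; apply/orP; left; apply/harcP; split; lra.
  by apply/orP; right; apply/orP; right; apply/harcP; split; rewrite /=; lra.
- have [lt|le] := ltP (- (r i + r j)) (X j - X i).
    by apply/orP; right; apply/orP; right; apply/harcP; split; rewrite /=; lra.
  by apply/orP; left; apply/orP; right; apply/harcP; split; lra.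
- have [lt|le] := ltP (- (r i + r j)) (X i - X j).
    by apply/orP; right; apply/orP; left; apply/harcP; split; rewrite /=; lra.
  by apply/orP; left; apply/orP; left; apply/harcP; split; lra.
Qed.

Lemma harcs_disjoint (F : realFieldType) (I : finType) (r X Y : I -> F) (i j : I) :
  (forall i, 0 < r i) ->
  sym_rel (harc r X Y) i j -> ~~ sym_rel (harc r Y (\- X)) i j.
Proof.
move=> r0 h; apply/negP => g; have := r0 i; have := r0 j.
by case/orP: h => /harcP [+ + +]; case/orP: g => /harcP [/= + + +]; lra.
Qed.

Lemma harcs_bound (F : realFieldType) (I : finType) (r X Y : I -> F) :
  (forall i, 0 < r i) -> separated r X Y -> unbalanced r -> (0 < #|I|)%N ->
  (arcs_in (harc r X Y) setT + arcs_in (harc r Y (\- X)) setT <= 2 * #|I| - 2)%N.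
Proof.
move=> r0 sep nw n0.
have GX := harc_digraph r0 sep; have GY := harc_digraph r0 (separated_rot sep).
have [dX|dX] := leqP #|I| (arcs_in (harc r X Y) setT).
  apply: (arcs_bound_of_dense r0 GX GY _ _ nw n0 dX).
    by move=> i j h; exact: harcs_disjoint r0 h.
  by move=> i j /orP [] /harcP [/= + + +]; lra.
have [dY|dY] := leqP #|I| (arcs_in (harc r Y (\- X)) setT).
  rewrite addnC; apply: (arcs_bound_of_dense r0 GY GX _ _ nw n0 dY).
    by move=> i j; apply: contraL => h; exact: harcs_disjoint r0 h.
  by move=> i j /orP [] /harcP [/= + + +]; lra.
by move: dX dY; move: (arcs_in _ _) (arcs_in _ _) #|I|; clear; lia.
Qed.

(** * From packings to the upper bound *)

Lemma card_sym_rel_le (n : nat) (e : rel 'I_n) :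
  (#|[set ij : 'I_n * 'I_n | (ij.1 < ij.2)%N && sym_rel e ij.1 ij.2]| <= arcs_in e setT)%N.
Proof.
pose f (ij : 'I_n * 'I_n) := if e ij.1 ij.2 then ij else (ij.2, ij.1).
rewrite -(@card_in_imset _ _ f) => [|[i j] [i' j']].
  apply: subset_leq_card; apply/subsetP => _ /imsetP [[i j] + ->].
  by rewrite !inE /f /= => /andP [_ /orP [] h]; rewrite ?h //; case: ifP.
rewrite !inE /f /= => /andP [ij _] /andP [ij' _].
case: ifP => _; case: ifP => _ // [E1 E2]; [| |by rewrite E1 E2].
- by move: ij ij'; rewrite E1 E2 => lt /ltnW; rewrite leqNgt lt.
- by move: ij ij'; rewrite E1 E2 => lt /ltnW; rewrite leqNgt lt.
Qed.

Lemma overlap_point (F : realFieldType) (a b s t : F) :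
  0 < s -> 0 < t -> `|a - b| < s + t -> exists q, `|q - a| < s /\ `|q - b| < t.
Proof.
move=> s0 t0; rewrite ltr_norml => /andP [h1 h2].
pose lo := Num.max (a - s) (b - t); pose hi := Num.min (a + s) (b + t).
exists ((lo + hi) / 2); rewrite !ltr_norml /lo /hi.
by case: (leP (a - s) (b - t)) => ?; case: (leP (a + s) (b + t)) => ?;
  split; apply/andP; split; lra.
Qed.

Lemma packing_separated (n : nat) (r : 'I_n -> R) (p : 'I_n -> point) :
  (forall i, 0 < r i) -> is_packing r p ->
  separated r (fun i => (p i).1) (fun i => (p i).2).
Proof.
move=> r0 pk i j ij.
have [|lx] := leP (r i + r j) `|(p i).1 - (p j).1|; first by left.
have [|ly] := leP (r i + r j) `|(p i).2 - (p j).2|; first by right.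
have [x [xi xj]] := overlap_point (r0 i) (r0 j) lx.
have [y [yi yj]] := overlap_point (r0 i) (r0 j) ly.
by case: (pk i j ij (x, y)).
Qed.

Lemma contacts_le (n : nat) (r : 'I_n -> R) (p : 'I_n -> point) :
  (0 < n)%N -> (forall i, 0 < r i) -> unbalanced r -> is_packing r p ->
  (contacts r p <= 2 * n - 2)%N.
Proof.
move=> n0 r0 nw pk; have sep := packing_separated r0 pk.
have := harcs_bound r0 sep nw; rewrite card_ord => /(_ n0); apply: leq_trans.
set X := (fun i => (p i).1); set Y := (fun i => (p i).2).
apply: leq_trans (leq_add (card_sym_rel_le _) (card_sym_rel_le _)).
apply: leq_trans (leq_card_setU _ _); apply: subset_leq_card.
apply/subsetP => -[i j]; rewrite !inE /= => /andP [ij /asboolP [q [[xi yi] [xj yj]]]].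
rewrite ij; apply: contact_arc => //; first by rewrite neq_ltn ij.
  by move: xi xj; rewrite !ler_norml /X => /andP [? ?] /andP [? ?]; apply/andP; split; lra.
by move: yi yj; rewrite !ler_norml /Y => /andP [? ?] /andP [? ?]; apply/andP; split; lra.
Qed.

(** * Stacking squares in two columns *)

Definition upd (T : eqType) (U : Type) (f : T -> U) (v : T) (x : U) : T -> U :=
  fun u => if u == v then x else f u.

(** Only heights are compared: all squares have a side on the axis, so two of them meet as soon as
    their vertical extents do. *)
Definition touching (n : nat) (r b : 'I_n -> R) (A : {set 'I_n}) : {set 'I_n * 'I_n} :=
  [set p | [&& p.1 \in A, p.2 \in A, (p.1 < p.2)%N,
    b p.1 <= b p.2 + 2 * r p.2 & b p.2 <= b p.1 + 2 * r p.1]].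

(* The squares of [A] stand in two columns on either side of the vertical axis: [sd] is the
   side, [b] the height of the bottom, [t] the height of each column. *)
Record stacking (n : nat) (r : 'I_n -> R) (A : {set 'I_n}) (sd : 'I_n -> bool)
    (b : 'I_n -> R) (t : bool -> R) : Prop := Stacking {
  stacking_ge0 : forall s, 0 <= t s;
  stacking_top : forall u, u \in A -> b u + 2 * r u <= t (sd u);
  stacking_disj : forall u v, u \in A -> v \in A -> u != v -> sd u = sd v ->
    b u + 2 * r u <= b v \/ b v + 2 * r v <= b u;
  stacking_cover : forall s (h : R), 0 <= h -> h <= t s ->
    exists u, [/\ u \in A, sd u = s, b u <= h & h <= b u + 2 * r u]
}.

Definition at_height (n : nat) (r b : 'I_n -> R) (A : {set 'I_n}) (h : R) : {set 'I_n} :=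
  [set u in A | (b u <= h) && (h <= b u + 2 * r u)].

Lemma at_height_ge2 (n : nat) (r : 'I_n -> R) A sd b t h :
  stacking r A sd b t -> 0 <= h -> (forall s, h <= t s) ->
  (2 <= #|at_height r b A h|)%N.
Proof.
move=> st h0 ht; apply/card_gt1P.
have [u [uA su u1 u2]] := stacking_cover st h0 (ht true).
have [v [vA sv v1 v2]] := stacking_cover st h0 (ht false).
exists u, v; rewrite !inE uA vA u1 u2 v1 v2; split=> //.
by apply: contraTneq isT => uv; move: su; rewrite uv sv.
Qed.

Lemma stacking_place (n : nat) (r : 'I_n -> R) A sd b t v s :
  (forall i, 0 < r i) -> stacking r A sd b t -> v \notin A ->
  stacking r (v |: A) (upd sd v s) (upd b v (t s)) (upd t s (t s + 2 * r v)).
Proof.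
move=> r0 st vA; have rv := r0 v.
have ne u : u \in A -> (u == v) = false.
  by move=> uA; apply: contraNF vA => /eqP <-.
have tle s' : t s' <= upd t s (t s + 2 * r v) s'.
  by rewrite /upd; case: eqP => [->|_]; lra.
split.
- by move=> s'; apply: le_trans (tle s'); exact: (stacking_ge0 st s').
- move=> u; rewrite in_setU1 => /orP [/eqP->|uA]; first by rewrite /upd !eqxx.
  have [-> ->] : upd b v (t s) u = b u /\ upd sd v s u = sd u by rewrite /upd (ne _ uA).
  by apply: le_trans (tle _); exact: (stacking_top st uA).
- have key u : u \in A -> sd u = s -> b u + 2 * r u <= t s.
    by move=> uA <-; exact: (stacking_top st uA).
  move=> u w; rewrite !in_setU1 /upd.
  case: eqVneq => [->|uv] /= uA; case: eqVneq => [->|wv] //= wA uw; rewrite ?eqxx //.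
  + by move=> sw; right; apply: key.
  + by move=> su; left; apply: key.
  + exact: (stacking_disj st uA wA uw).
- move=> s' h h0 ht.
  have [hle|hlt] := leP h (t s').
    have [u [uA su u1 u2]] := stacking_cover st h0 hle.
    by exists u; rewrite in_setU1 uA orbT /upd (ne _ uA).
  move: ht; rewrite {1}/upd; case: eqP => [E|_] ht; last by move: hlt; rewrite ltNge ht.
  by exists v; rewrite in_setU1 eqxx /upd eqxx; split=> //; rewrite -E ltW.
Qed.

(** A square with bottom at [h] touches every square whose extent contains [h]; these pairs involve
    [v] and so are new. *)
Lemma touching_place (n : nat) (r b : 'I_n -> R) (A : {set 'I_n}) (v : 'I_n) (h : R) :
  0 < r v -> v \notin A ->
  (#|touching r b A| + #|at_height r b A h| <= #|touching r (upd b v h) (v |: A)|)%N.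
Proof.
move=> rv vA.
have ne u : u \in A -> (u == v) = false.
  by move=> uA; apply: contraNF vA => /eqP <-.
pose f (u : 'I_n) := if (u < v)%N then (u, v) else (v, u).
have finj : {in at_height r b A h &, injective f}.
  move=> u w; rewrite !inE => /andP [uA _] /andP [wA _]; rewrite /f.
  by case: ifP => _; case: ifP => _ [] // E1 E2; rewrite ?E1 ?E2 //; move: (ne _ uA) (ne _ wA); rewrite ?E1 ?E2 ?eqxx.
rewrite -(card_in_imset finj) -cardsUI [X in (_ + X)%N](_ : _ = 0%N) ?addn0.
  apply: subset_leq_card; apply/subsetP => -[i j]; rewrite inE => /orP [].
    rewrite !inE /= => /and5P [iA jA -> h1 h2].
    by rewrite iA jA !orbT /upd (ne _ iA) (ne _ jA) h1 h2.
  case/imsetP => u; rewrite inE => /and3P [uA u1 u2].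
  have uv : (u : nat) != v by apply/negP => /eqP/val_inj/eqP; rewrite ne.
  rewrite /f; case: ltnP => uv' [-> ->]; rewrite !inE /= eqxx uA ?orbT /upd eqxx (ne _ uA) /=.
    by rewrite uv'; apply/andP; split; lra.
  by rewrite ltn_neqAle eq_sym uv uv'; apply/andP; split; lra.
apply/eqP; rewrite cards_eq0; apply/eqP/setP => -[i j]; rewrite !inE /=.
apply/negP => /andP [/and5P [iA jA _ _ _] /imsetP [u _]].
rewrite /f; case: ifP => _ [E1 E2]; move: vA; first by rewrite -E2 jA.
by rewrite -E1 iA.
Qed.

(** The deficit [d] of contacts against two per square starts at 3 and drops by one at each tie;
    reaching 1 means [2 * n - 1] contacts. *)
Definition stackable (n : nat) (r : 'I_n -> R) (A : {set 'I_n}) (t : bool -> R) (d : nat) :=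
  exists sd b, stacking r A sd b t /\ (2 * #|A| <= #|touching r b A| + d)%N.

Lemma stackable_init (n : nat) (r : 'I_n -> R) (u v : 'I_n) :
  (forall i, 0 < r i) -> u != v -> stackable r [set u; v] (fun=> 0) 3.
Proof.
move=> r0 uv; have ru := r0 u; have rv := r0 v.
have vu : (v == u) = false by rewrite eq_sym (negbTE uv).
(* Both squares hang below level 0, so the columns start level and [stacking_cover] concerns only
   [h = 0]. *)
exists (fun w => w == u), (fun w => - (2 * r w)); split.
  split.
  - by move=> _.
  - by move=> w _; lra.
  - move=> a b; rewrite !inE => /orP [] /eqP -> /orP [] /eqP ->; rewrite ?eqxx ?vu //.
  - move=> s h h0 h1; exists (if s then u else v).
    by case: s h1 => h1; rewrite !inE !eqxx ?orbT ?vu; split=> //; lra.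
rewrite cards2 uv -[(2 * _)%N]/(1 + 3)%N leq_add2r.
apply/card_gt0P; exists (if (u < v)%N then (u, v) else (v, u)).
case: ltnP => lt; rewrite !inE /= !eqxx ?orbT /=.
  by rewrite lt /=; apply/andP; split; lra.
have -> : (v < u)%N by rewrite ltn_neqAle lt andbT eq_sym.
by apply/andP; split; lra.
Qed.

(** On the lower column the new bottom is at a height reached by both columns, so it meets a square
    in each. *)
Lemma stackable_place (n : nat) (r : 'I_n -> R) A t d v s :
  (forall i, 0 < r i) -> stackable r A t d -> v \notin A -> t s <= t (~~ s) ->
  stackable r (v |: A) (upd t s (t s + 2 * r v)) d.
Proof.
move=> r0 [sd [b [st cnt]]] vA ts.
exists (upd sd v s), (upd b v (t s)); split; first exact: stacking_place.
have h2 : (2 <= #|at_height r b A (t s)|)%N.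
  apply: (at_height_ge2 st); first exact: (stacking_ge0 st).
  by move=> s'; case: (eqVneq s' s) => [->|] //; rewrite -addbN; case: s' s ts => -[].
have := touching_place b (t s) (r0 v) vA; rewrite cardsU1 vA; move: cnt h2.
move: #|touching _ _ _| #|touching _ _ _| #|at_height _ _ _ _| #|A|; clear; lia.
Qed.

(** The second square [w] has its bottom level with that of [v], so it touches [v] besides one
    square in each column. *)
Lemma stackable_tie (n : nat) (r : 'I_n -> R) A t d v w :
  (forall i, 0 < r i) -> stackable r A t d.+1 -> v \notin A -> w \notin A -> v != w ->
  t true = t false ->
  stackable r (w |: (v |: A)) (fun s => if s then t true + 2 * r v else t false + 2 * r w) d.
Proof.
move=> r0 [sd [b [st cnt]]] vA wA vw tt.
have st1 := stacking_place true r0 st vA.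
have wA1 : w \notin v |: A by rewrite in_setU1 negb_or eq_sym vw.
have st2 := stacking_place false r0 st1 wA1.
set t1 := upd t _ _ in st1 st2; set b1 := upd b _ _ in st1 st2.
have tE : upd t1 false (t1 false + 2 * r w) =
    (fun s => if s then t true + 2 * r v else t false + 2 * r w).
  by apply/funext => -[].
rewrite tE in st2; eexists; eexists; split; first exact: st2.
have h2 : (2 <= #|at_height r b A (t true)|)%N.
  apply: (at_height_ge2 st); first exact: (stacking_ge0 st).
  by case; rewrite tt.
have h3 : (#|at_height r b A (t true)| < #|at_height r b1 (v |: A) (t1 false)|)%N.
  have sub : v |: at_height r b A (t true) \subset at_height r b1 (v |: A) (t1 false).
    apply/subsetP => u; rewrite /t1 /b1 /upd /= -tt !inE; case: (eqVneq u v) => [->|uv] /=.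
      by move=> _; rewrite lexx /=; have := r0 v; lra.
    by [].
  have := subset_leq_card sub; rewrite cardsU1 inE (negbTE vA) /=; exact.
have := touching_place b (t true) (r0 v) vA; rewrite -/b1.
have := touching_place b1 (t1 false) (r0 w) wA1.
rewrite !cardsU1 wA1 vA; move: cnt h2 h3.
move: #|touching _ _ _| #|touching _ _ _| #|touching _ _ _| #|at_height _ _ _ _|
  #|at_height _ _ _ _| #|A|; clear; lia.
Qed.

Lemma stackable_fill (n : nat) (r : 'I_n -> R) A t d :
  (forall i, 0 < r i) -> stackable r A t d -> exists t', stackable r setT t' d.
Proof.
move=> r0; elim: {A}#|~: A| {-2}A (erefl #|~: A|) t => [|k IH] A cA t st.
  move/eqP: cA; rewrite cards_eq0 -setCT => /eqP/(congr1 (@setC _)); rewrite !setCK => AE.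
  by exists t; rewrite -AE.
have [v vA] : exists v, v \in ~: A by apply/set0Pn; rewrite -card_gt0 cA.
have [s ts] : exists s, t s <= t (~~ s).
  by case: (leP (t true) (t false)) => h; [exists true|exists false; apply: ltW].
move: (vA); rewrite inE => vA'.
apply: IH (stackable_place r0 st vA' ts).
have := cardsD1 v (~: A); rewrite vA cA setCU setDE setIC => -[] //.
Qed.

(** [Q s] is what remains for column [s]. The lower column always has a square left, since otherwise
    the other column would end strictly higher. *)
Lemma stackable_balance (n : nat) (r : 'I_n -> R) A (Q : bool -> {set 'I_n}) t d :
  (forall i, 0 < r i) -> stackable r A t d ->
  [disjoint Q true & Q false] -> (forall s, [disjoint Q s & A]) ->
  t true + 2 * (\sum_(i in Q true) r i) = t false + 2 * (\sum_(i in Q false) r i) ->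
  exists t', stackable r (A :|: (Q true :|: Q false)) t' d /\ t' true = t' false.
Proof.
move=> r0; move cQ: (#|Q true| + #|Q false|)%N => k.
elim: k Q cQ A t => [|k IH] Q cQ A t st QQ QA bal.
  move/eqP: cQ; rewrite addn_eq0 !cards_eq0 => /andP [/eqP Q1 /eqP Q0].
  exists t; rewrite Q1 Q0 !setU0; split=> //.
  by move: bal; rewrite Q1 Q0 !big_set0; lra.
have [s ts] : exists s, t s <= t (~~ s).
  by case: (leP (t true) (t false)) => h; [exists true|exists false; apply: ltW].
have bal' : t s + 2 * (\sum_(i in Q s) r i) = t (~~ s) + 2 * (\sum_(i in Q (~~ s)) r i).
  by case: (s); rewrite ?bal.
have [v vQ] : exists v, v \in Q s.
  apply/set0Pn/negP => /eqP Qs.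
  have [w wQ] : exists w, w \in Q (~~ s).
    apply/set0Pn; rewrite -card_gt0; move: cQ Qs.
    by case: (s) => /= cQ Qs; move: cQ; rewrite Qs cards0 ?addn0 ?add0n => ->.
  move: bal'; rewrite Qs big_set0 (bigD1 w) //=.
  have : 0 <= \sum_(i in Q (~~ s) | i != w) r i by apply: sumr_ge0 => i _; apply: ltW.
  by have := r0 w; lra.
have vA : v \notin A by move: (QA s); rewrite disjoint_subset => /subsetP /(_ v vQ).
have st' := stackable_place r0 st vA ts.
pose Q' s' := if s' == s then Q s :\ v else Q s'.
have sub s' : Q' s' \subset Q s'.
  by rewrite /Q'; case: eqP => [->|_]; [apply: subD1set|].
have QE s' : s' != s -> Q' s' = Q s' by rewrite /Q' => /negbTE ->.
have Qs' : Q' s = Q s :\ v by rewrite /Q' eqxx.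
have UE : v |: A :|: (Q' true :|: Q' false) = A :|: (Q true :|: Q false).
  apply/setP => u; rewrite /Q'; move: vQ; case: (s) => vQ; rewrite !inE;
    case: (eqVneq u v) => [->|_] //=; by rewrite vQ ?orbT.
rewrite -UE; apply: (IH Q' _ _ _ st').
- move: cQ vQ; rewrite /Q'; case: (s) => /= + vQ.
    by rewrite (cardsD1 v (Q true)) vQ => -[].
  by rewrite (cardsD1 v (Q false)) vQ addnCA => -[].
- by apply: disjointWl (sub true) _; apply: disjointWr (sub false) _.
- move=> s'; rewrite disjoint_subset; apply/subsetP => u uQ'.
  have uA : u \notin A.
    by move: (QA s'); rewrite disjoint_subset => /subsetP; apply; apply: (subsetP (sub s')).
  rewrite !inE negb_or uA andbT; apply/eqP => uv; move: uQ'; rewrite uv.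
  case: (eqVneq s' s) => [->|s's]; first by rewrite Qs' !inE eqxx.
  rewrite QE //; apply/negP; move: QQ vQ s's; case: (s); case: (s') => // + vQ _.
    by rewrite disjoint_subset => /subsetP /(_ v vQ).
  by rewrite disjoint_sym disjoint_subset => /subsetP /(_ v vQ).
- move: bal vQ; rewrite /Q' /upd; case: (s) => /= + vQ; rewrite (big_setD1 v vQ) /=; lra.
Qed.

(** * Packings with too many contacts *)

Lemma stackable_packing (n : nat) (r : 'I_n -> R) t d :
  (forall i, 0 < r i) -> stackable r setT t d ->
  exists p, is_packing r p /\ (2 * n <= contacts r p + d)%N.
Proof.
move=> r0 [sd [b [st cnt]]].
exists (fun i => (if sd i then r i else - r i, b i + r i)); split.
  move=> i j ij [x y] [[/= + +] [/= + +]]; rewrite !ltr_norml.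
  move=> /andP [x1 x2] /andP [y1 y2] /andP [x3 x4] /andP [y3 y4].
  have [sij|] := eqVneq (sd i) (sd j).
    have [] := stacking_disj st (in_setT i) (in_setT j) ij sij; lra.
  have ri := r0 i; have rj := r0 j.
  by move: x1 x2 x3 x4; case: (sd i); case: (sd j) => //; lra.
move: cnt; rewrite cardsT card_ord => /leq_trans; apply; rewrite leq_add2r.
apply: subset_leq_card; apply/subsetP => -[i j]; rewrite !inE /= => /and3P [-> h1 h2].
have ri := r0 i; have rj := r0 j.
(* A common point lies on the axis at the height of the higher bottom. *)
apply/asboolP; exists (0, Num.max (b i) (b j)).
have x0 k : `|0 - (if sd k then r k else - r k)| <= r k.
  by rewrite sub0r normrN; case: (sd k); rewrite ?normrN gtr0_norm.
split; split; rewrite ?x0 //= ler_norml; case: (leP (b i) (b j)) => ?; apply/andP; split; lra.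
Qed.

Lemma packing_of_balanced (n : nat) (r : 'I_n -> R) (sigma : 'I_n -> int) :
  (forall i, 0 < r i) -> (forall i, sigma i \in [:: -1; 0; 1]) ->
  (4 <= #|[set i | sigma i == 0%R]|)%N ->
  \sum_(i < n) (sigma i)%:~R * r i = 0 -> (exists i, sigma i != 0) ->
  exists p, is_packing r p /\ (2 * n <= contacts r p + 1)%N.
Proof.
move=> r0 sP z4 sum0 [i0 si0].
pose Q (s : bool) := [set i | sigma i == if s then 1 else -1].
have QQ : [disjoint Q true & Q false].
  by rewrite disjoint_subset; apply/subsetP => i; rewrite !inE => /eqP ->.
have balQ : \sum_(i in Q true) r i = \sum_(i in Q false) r i.
  apply/subr0_eq; rewrite -[RHS]sum0 big_mkcond [X in _ - X]big_mkcond -sumrB.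
  apply: eq_bigr => i _; rewrite !inE; move: (sP i); rewrite !inE.
  by case/or3P => /eqP -> /=; ring.
have Qpos s : Q s != set0 -> 0 < \sum_(i in Q s) r i.
  move=> /set0Pn [i iQ]; rewrite (bigD1 i) //=.
  have : 0 <= \sum_(j in Q s | j != i) r j by apply: sumr_ge0 => j _; apply: ltW.
  by have := r0 i; lra.
have Qeq : (Q true == set0) = (Q false == set0).
  apply/idP/idP => /eqP E; apply/negPn/negP => /Qpos; move: balQ; rewrite E big_set0.
    by move=> <-; rewrite ltxx.
  by move=> ->; rewrite ltxx.
have Qn0 s : Q s != set0.
  have : (Q true != set0) || (Q false != set0).
    move: (sP i0) si0; rewrite !inE; case/or3P => /eqP E; rewrite E // => _.
      by apply/orP; right; apply/set0Pn; exists i0; rewrite inE E.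
    by apply/orP; left; apply/set0Pn; exists i0; rewrite inE E.
  by rewrite Qeq orbb; case: s => //; rewrite Qeq.
have /set0Pn [a aQ] := Qn0 true; have /set0Pn [b bQ] := Qn0 false.
have [c [cu cs cz]] : exists c : seq 'I_n, [/\ uniq c, size c = 4%N & forall i, i \in c -> sigma i = 0].
  exists (take 4 (enum [set i | sigma i == 0])); rewrite take_uniq ?enum_uniq //.
  rewrite size_takel -?cardE //; split=> // i /mem_take.
  by rewrite mem_enum inE => /eqP.
case: c cu cs cz => [|c1 [|c2 [|c3 [|c4 [|]]]]] //= cu _ cz.
move: cu; rewrite !inE !negb_or => /and4P [/and3P [c12 c13 c14] /andP [c23 c24] c34 _].
have z1 : sigma c1 = 0 by apply: cz; rewrite !inE eqxx ?orbT.
have z2 : sigma c2 = 0 by apply: cz; rewrite !inE eqxx ?orbT.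
have z3 : sigma c3 = 0 by apply: cz; rewrite !inE eqxx ?orbT.
have z4' : sigma c4 = 0 by apply: cz; rewrite !inE eqxx ?orbT.
move: (aQ) (bQ); rewrite !inE => /eqP sa /eqP sb.
have ne i j : sigma i != sigma j -> i != j by apply: contraNneq => ->.
have st0 := stackable_init r0 c12.
have aA : a \notin [set c1; c2] by rewrite !inE negb_or !ne // sa ?z1 ?z2.
have bA : b \notin [set c1; c2] by rewrite !inE negb_or !ne // sb ?z1 ?z2.
have ab : a != b by rewrite ne // sa sb.
(* The columns are level over [c1] and [c2]; the first tie is spent on one square of each sign, and
   the rest of [Q] restores equal heights. *)
have st1 := stackable_tie r0 st0 aA bA ab (erefl _).
pose Q' (s : bool) := Q s :\ (if s then a else b).
have [t [st2 tt]] : exists t', stackable r (b |: (a |: [set c1; c2]) :|: (Q' true :|: Q' false)) t' 2 /\ t' true = t' false.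
  apply: (stackable_balance r0 st1).
  - apply: disjointWl (subD1set _ _) _; exact: disjointWr (subD1set _ _) QQ.
  - move=> s; rewrite disjoint_subset; apply/subsetP => i; rewrite !inE => /andP [ia /eqP si].
    move: ia si; case: s => ia si; rewrite !negb_or ?ia ?andbT /= !ne ?si ?sa ?sb ?z1 ?z2 //.
  - by move: balQ; rewrite (big_setD1 a aQ) /= (big_setD1 b bQ) /= /Q'; lra.
have cN i : sigma i = 0 -> i != c1 -> i != c2 ->
    i \notin b |: (a |: [set c1; c2]) :|: (Q' true :|: Q' false).
  move=> si i1 i2; rewrite !inE si !andbF !orbF !negb_or i1 i2 !ne // si ?sa ?sb //.
have c3N : c3 \notin b |: (a |: [set c1; c2]) :|: (Q' true :|: Q' false).
  by apply: cN => //; rewrite eq_sym.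
have c4N : c4 \notin b |: (a |: [set c1; c2]) :|: (Q' true :|: Q' false).
  by apply: cN => //; rewrite eq_sym.
(* The second tie takes [c3] and [c4]; the remaining squares have sign zero and go on the lower
   column. *)
have [t' st3] := stackable_fill r0 (stackable_tie r0 st2 c3N c4N c34 tt).
exact: stackable_packing r0 st3.
Qed.

Theorem theorem1 (n : nat) (hn : (0 < n)%N) (r : 'I_n -> R)
    (hr : forall i, 0 < r i) :
  (forall p : 'I_n -> point, is_packing r p -> (contacts r p <= 2 * n - 2)%N)
  <->
  (forall sigma : 'I_n -> int,
      (forall i, sigma i \in [:: -1; 0; 1]) ->
      (4 <= #|[set i | sigma i == 0]|)%N ->
      \sum_(i < n) (sigma i)%:~R * r i = 0 ->
      forall i, sigma i = 0).
Proof.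
split=> [few sigma sP z4 sum0 i|nw p pk]; last exact: contacts_le.
apply/eqP/negPn/negP => si.
have [p [pk many]] := packing_of_balanced hr sP z4 sum0 (ex_intro _ i si).
by have := few p pk; move: many; move: (contacts r p) hn; clear; lia.
Qed.
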